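(* For every $d\in\mathbb N$ there exists a constant $c(d)>0$ such that for every finite nonempty set $Q\subset\mathbb Z^d$, every measurable set $B\subset\mathbb T^d$ with $|B|\le c(d)2^{-4|Q|}|Q|^{-2}$, and every $f\in\mathcal T(Q)$, $$ \|f\|_{L_\infty(\mathbb T^d)}\le12\|f\|_{L_\infty(\mathbb T^d\setminus B)}. $$
   Context: $\mathbb T^d=[0,2\pi)^d$ (the $d$-dimensional torus), $|B|$ denotes the normalized Lebesgue measure $(2\pi)^{-d}\lambda(B)$ of $B$, and $|Q|$ is the cardinality of $Q$. $\mathcal T(Q)=\{f(\mathbf x)=\sum_{\mathbf k\in Q}c_{\mathbf k}e^{i(\mathbf k,\mathbf x)}: c_{\mathbf k}\in\mathbb C\}$. $\|f\|_{L_\infty(S)}=\sup_{\mathbf x\in S}|f(\mathbf x)|$. *)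

(* Defs.v *)
From HB Require Import structures.
From mathcomp Require Import all_boot all_order all_algebra finmap.
From mathcomp Require Import all_classical all_reals all_analysis.
From mathcomp Require Import complex.
Set Implicit Arguments. Unset Strict Implicit. Unset Printing Implicit Defensive.
Import Order.TTheory GRing.Theory Num.Theory.
Local Open Scope classical_set_scope.
Local Open Scope ring_scope.

Section Torus.
Variables (R : realType) (d : nat).

Definition box (a b : 'rV[R]_d) : set 'rV[R]_d :=
  [set x | forall i : 'I_d, a 0 i <= x 0 i < b 0 i].

Definition box_vol (a b : 'rV[R]_d) : R :=
  \prod_(i < d) Num.max 0 (b 0 i - a 0 i).

(** A countable cover is a sequence of optional boxes ([None] = empty set,
    needed so that covers may use finitely many boxes, e.g. when d = 0). *)
Definition obox (o : option ('rV[R]_d * 'rV[R]_d)) : set 'rV[R]_d :=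
  if o is Some ab then box ab.1 ab.2 else set0.
Definition obox_vol (o : option ('rV[R]_d * 'rV[R]_d)) : R :=
  if o is Some ab then box_vol ab.1 ab.2 else 0.

Definition leb_outer (A : set 'rV[R]_d) : \bar R :=
  ereal_inf [set s : \bar R | exists F : nat -> option ('rV[R]_d * 'rV[R]_d),
     A `<=` \bigcup_n obox (F n) /\
     s = (\sum_(0 <= n <oo) (obox_vol (F n))%:E)%E].

Definition leb_measurable (A : set 'rV[R]_d) : Prop :=
  forall E : set 'rV[R]_d, leb_outer E = (leb_outer (E `&` A) + leb_outer (E `&` ~` A))%E.

Definition torus : set 'rV[R]_d := [set x | forall i : 'I_d, 0 <= x 0 i < 2 * pi].

Definition nmeasure (B : set 'rV[R]_d) : \bar R :=
  (((2 * pi) ^- d)%:E * leb_outer B)%E.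

Definition dotZR (k : 'rV[int]_d) (x : 'rV[R]_d) : R :=
  \sum_(i < d) (k 0 i)%:~R * x 0 i.

Definition expi (t : R) : R[i] := (cos t +i* sin t)%C.

Definition trig_poly (Q : {fset 'rV[int]_d}) (f : 'rV[R]_d -> R[i]) : Prop :=
  exists c : 'rV[int]_d -> R[i],
    forall x, f x = \sum_(k <- Q) c k * expi (dotZR k x).

(** sup-norm ||f||_{L_inf(S)} (as an extended real; -oo if S is empty). *)
Definition sup_norm (f : 'rV[R]_d -> R[i]) (S : set 'rV[R]_d) : \bar R :=
  ereal_sup [set (ComplexField.Normc.normc (f x))%:E | x in S].

End Torus.

(* Main.v *)
Require Import Defs.
From HB Require Import structures.
From mathcomp Require Import all_boot all_order all_algebra finmap.
From mathcomp Require Import all_classical all_reals all_analysis.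
From mathcomp Require Import complex ring lra.
Import Order.TTheory GRing.Theory Num.Theory.
Import numFieldNormedType.Exports.
Import ComplexField.Normc.
Local Open Scope classical_set_scope.
Local Open Scope ring_scope.

(** Let N = |Q| and let A = |f(x0)| be nearly maximal. The frequencies of f^N
are sums of N elements of Q, so there are at most C(2N-1, N-1) <= 4^N of them,
and Cauchy-Schwarz with Parseval gives A^(2N) <= 4^N avg |f|^(2N). The points
where |f| < A/12 contribute at most 4^N (A/12)^(2N) = A^(2N)/36^N to the right
side, so {|f| >= A/12} has normalized measure at least (35/36) 8^-N, the loss
from 4^-N to 8^-N being due to A only being nearly maximal. A smaller set B
therefore cannot contain {|f| >= A/12}; c(d) = 1/4 works for every d.

Instead of integrating, one averages over the grids (2 pi/M) {0..M-1}^d: Parseval is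
exact there for large M, and if a compact set is covered by boxes of total volume V,
it contains at most (V + o(1)) (M/2pi)^d grid points. *)

(** * The exponential e^(it) of a real argument *)

Section Exponentials.
Variables (R : realType).
Implicit Types (s t : R) (z w : R[i]).

Lemma expiD s t : expi (s + t) = expi s * expi t.
Proof.
apply/eqP; rewrite eq_complex /= cosD sinD; apply/andP; split; apply/eqP => //.
by rewrite addrC [sin s * _]mulrC [cos s * sin t]mulrC [cos t * _]mulrC [sin t * _]mulrC.
Qed.

Lemma expi0 : expi 0 = 1 :> R[i].
Proof. by rewrite /expi cos0 sin0. Qed.

Lemma normc_expi t : normc (expi t) = 1.
Proof. by rewrite /= cos2Dsin2 sqrtr1. Qed.

Lemma conj_expi t : ((expi t)^*)%C = expi (- t).
Proof. by rewrite /expi cosN sinN. Qed.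

Lemma expiMn t n : expi (t *+ n) = expi t ^+ n.
Proof. by elim: n => [|n IH]; rewrite ?mulr0n ?expi0// mulrS expiD IH exprS. Qed.

Lemma expi_sum (I : Type) (r : seq I) (P : pred I) (F : I -> R) :
  expi (\sum_(i <- r | P i) F i) = \prod_(i <- r | P i) expi (F i).
Proof. by apply: (big_morph _ expiD expi0). Qed.

Lemma expi_2pi_int (m : int) : expi (2 * pi * m%:~R : R) = 1.
Proof.
have h n : expi (2 * pi * n%:R : R) = 1.
  rewrite mulr_natr expiMn [2 * pi]mulr_natl /expi.
  by rewrite cos2pi sin2pi expr1n.
case: m => n; first exact: h.
rewrite NegzE rmorphN/= mulrN -conj_expi; have := h n.+1; rewrite pmulrn => ->.
by apply/eqP; rewrite eq_complex /= oppr0 !eqxx.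
Qed.

(** By the half-angle formula cos t = 1 - 2 sin^2(t/2), and t/2 lies in (0, pi), where the sine is
    positive. *)
Lemma cos_neq1 t : 0 < t < 2 * pi -> cos t != 1.
Proof.
move=> /andP[t0 tpi].
have s0 : 0 < sin (t / 2) by apply: sin_gt0_pi; lra.
have -> : t = (t / 2) *+ 2 by rewrite -mulr_natr; field.
rewrite cos_mulr2n cos2sin2; apply/eqP => h.
have : sin (t / 2) ^+ 2 = 0.
  move: h; rewrite mulrnBl -mulr_natr; lra.
by move/eqP; rewrite sqrf_eq0 gt_eqF.
Qed.

Lemma expi_neq1 t : 0 < `|t| < 2 * pi -> expi t != 1.
Proof.
move=> /cos_neq1; apply: contra => /eqP /(congr1 (@complex.Re _)) /= ct.
by case: (ger0P t) => _; rewrite ?cosN ct.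
Qed.

Lemma sumX_unity_root z n : z ^+ n = 1 -> z != 1 -> \sum_(i < n) z ^+ i = 0.
Proof.
move=> zn z1; apply: (mulfI (_ : z - 1 != 0)); first by rewrite subr_eq0.
by rewrite -subrX1 zn subrr mulr0.
Qed.

End Exponentials.

(** * Orthogonality of the exponentials on a grid *)

Section Grid.
Variables (R : realType) (d : nat).
Implicit Types (k : 'rV[int]_d) (x : 'rV[R]_d).

Definition grid (M : nat) (j : {ffun 'I_d -> 'I_M}) : 'rV[R]_d :=
  \row_i (2 * pi * (j i)%:R / M%:R).

Lemma dotZRD k l x : dotZR (k + l) x = dotZR k x + dotZR l x.
Proof.
rewrite /dotZR -big_split/=; apply: eq_bigr => i _.
by rewrite mxE rmorphD mulrDl.
Qed.

Lemma dotZRN k x : dotZR (- k) x = - dotZR k x.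
Proof.
by rewrite /dotZR -sumrN; apply: eq_bigr => i _; rewrite mxE rmorphN mulNr.
Qed.

Lemma dotZR0 x : dotZR 0 x = 0.
Proof. by rewrite /dotZR big1// => i _; rewrite mxE mul0r. Qed.

Lemma dotZR_sum (I : Type) (r : seq I) (P : pred I) (F : I -> 'rV[int]_d) x :
  dotZR (\sum_(i <- r | P i) F i) x = \sum_(i <- r | P i) dotZR (F i) x.
Proof.
exact: (big_morph (fun k => dotZR k x) (fun k l => dotZRD k l x) (dotZR0 x)).
Qed.

(** The sum factors into d geometric sums, one per coordinate, with ratio e^(2 pi i k_i / M). This
    ratio is an M-th root of unity, and it differs from 1 as soon as 0 < |k_i| < M; one nonzero
    coordinate therefore kills the product. *)
Lemma sum_expi_grid M k : (0 < M)%N ->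
  (forall i, (`|k 0%R i| < M)%N) ->
  \sum_(j : {ffun 'I_d -> 'I_M}) expi (dotZR k (grid M j)) = ((k == 0) * M ^ d)%:R.
Proof.
move=> M0 kM; have MR : M%:R != 0 :> R by rewrite pnatr_eq0 -lt0n.
pose z i := expi (2 * pi * (k 0 i)%:~R / M%:R) : R[i].
have -> : \sum_(j : {ffun 'I_d -> 'I_M}) expi (dotZR k (grid M j)) =
    \prod_(i < d) \sum_(l < M) z i ^+ l.
  rewrite bigA_distr_bigA/=; apply: eq_bigr => j _.
  rewrite /dotZR expi_sum; apply: eq_bigr => i _.
  rewrite -expiMn mxE -[_ *+ j i]mulr_natr; congr expi; ring.
have [k0|k0] := eqVneq k 0; rewrite ?mul1n ?mul0n.
  rewrite (eq_bigr (fun=> M%:R)) ?prodr_const ?card_ord ?natrX// => i _.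
  rewrite (eq_bigr (fun=> 1)) ?sumr_const ?card_ord// => l _.
  by rewrite /z k0 mxE mulr0 mul0r expi0 expr1n.
have [i ki] : exists i, k 0 i != 0.
  apply/existsP; apply: contraR k0; rewrite negb_exists => /forallP h.
  apply/eqP/rowP => i; rewrite mxE; apply/eqP.
  by have := h i; rewrite negbK.
rewrite (bigD1 i)//= sumX_unity_root ?mul0r//.
  rewrite -expiMn -[_ *+ M]mulr_natr divfK// expi_2pi_int//.
apply: expi_neq1; have p0 := pi_gt0 R.
rewrite !normrM (gtr0_norm p0) ger0_norm// normfV normr_nat -intr_norm.
have Mp : 0 < M%:R :> R by rewrite ltr0n.
apply/andP; split.
  by rewrite !mulr_gt0 ?invr_gt0// ltr0z normr_gt0.
rewrite ltr_pdivrMr// ltr_pM2l ?mulr_gt0//.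
by rewrite -abszE pmulrn ltr_nat.
Qed.

End Grid.

(** * Cauchy-Schwarz and Parseval on the grid *)

(** Cauchy-Schwarz against the constant 1: both sides are double sums, compared termwise by x_i x_j
    <= (x_i^2 + x_j^2) / 2. *)
Lemma sqr_sum_le (R : realFieldType) (I : Type) (r : seq I) (x : I -> R) :
  (\sum_(i <- r) x i) ^+ 2 <= (size r)%:R * \sum_(i <- r) x i ^+ 2.
Proof.
have -> : (size r)%:R * \sum_(i <- r) x i ^+ 2 =
    \sum_(i <- r) \sum_(j <- r) (x i ^+ 2 + x j ^+ 2) / 2.
  rewrite [RHS](eq_bigr (fun i => (x i ^+ 2 *+ size r + \sum_(j <- r) x j ^+ 2) / 2)).
    rewrite -mulr_suml big_split/= [in X in _ + X]big_const_seq count_predT.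
    by rewrite iter_addr_0 sumrMnl -(mulr_natl (\sum_(i <- r) _)); field.
  move=> i _; rewrite -mulr_suml big_split/= big_const_seq count_predT.
  by rewrite iter_addr_0.
rewrite expr2 big_distrlr/=; apply: ler_sum => i _; apply: ler_sum => j _.
by have := sqr_ge0 (x i - x j); rewrite sqrrB; lra.
Qed.

Section Parseval.
Variables (R : realType) (d : nat).
Implicit Types (P : {fset 'rV[int]_d}) (a : 'rV[int]_d -> R[i]).

Lemma normCE (z : R[i]) : `|z| = (normc z)%:C%C.
Proof. by rewrite normc_def; case: z. Qed.

Lemma normc_ge0 (z : R[i]) : 0 <= normc z.
Proof. by case: z => a b; exact: sqrtr_ge0. Qed.

(** Expanding the square gives the frequencies q - r. Their coordinates are below M in absolute
    value, so no two distinct frequencies are aliased and only the diagonal q = r survives. *)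
Lemma parseval_grid P a (M : nat) : (0 < M)%N ->
  (forall q r i, q \in P -> r \in P -> (`|q 0%R i - r 0%R i| < M)%N) ->
  \sum_(j : {ffun 'I_d -> 'I_M})
     `|\sum_(q <- P) a q * expi (dotZR q (grid R d M j))| ^+ 2 =
  (M ^ d)%:R * \sum_(q <- P) `|a q| ^+ 2.
Proof.
move=> M0 PM.
have E j : `|\sum_(q <- P) a q * expi (dotZR q (grid R d M j))| ^+ 2 =
   \sum_(q <- P) \sum_(r <- P) a q * (a r)^*%C * expi (dotZR (q - r) (grid R d M j)).
  have conjM (u v : R[i]) : (u * v)^*%C = u^*%C * v^*%C by rewrite rmorphM.
  have cE : ((\sum_(q <- P) a q * expi (dotZR q (grid R d M j)))^*%C : R[i]) =
      \sum_(q <- P) (a q)^*%C * expi (- dotZR q (grid R d M j)).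
    by rewrite rmorph_sum; apply: eq_bigr => q _; rewrite [LHS]conjM conj_expi.
  rewrite sqr_normc cE big_distrlr.
  apply: eq_bigr => q _; apply: eq_bigr => r _.
  by rewrite dotZRD dotZRN expiD mulrACA.
rewrite (eq_bigr _ (fun j _ => E j)) exchange_big/= mulr_sumr.
rewrite !big_seq; apply: eq_bigr => q qP.
rewrite exchange_big/= (big_fsetD1 q)//= [X in _ + X]big_seq [X in _ + X]big1 ?addr0 => [|r].
  rewrite -mulr_sumr sum_expi_grid// => [|i]; last by rewrite subrr mxE.
  by rewrite subrr eqxx mul1n -sqr_normc mulrC.
rewrite !inE => /andP[rq rP]; rewrite -mulr_sumr sum_expi_grid// => [|i].
  by rewrite subr_eq0 eq_sym (negbTE rq) mul0n mulr0.
by rewrite !mxE PM.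
Qed.

Lemma normc_sum_expi_le (r : seq 'rV[int]_d) a x :
  normc (\sum_(q <- r) a q * expi (dotZR q x)) <= \sum_(q <- r) normc (a q).
Proof.
rewrite -lecR -normCE rmorph_sum/=; apply: le_trans (ler_norm_sum _ _ _) _.
by apply: ler_sum => q _; rewrite normrM !normCE normc_expi mulr1.
Qed.

Lemma sqr_normc_le_grid P (g : 'rV[R]_d -> R[i]) : trig_poly P g ->
  exists M0, forall M, (M0 <= M)%N -> forall x,
   normc (g x) ^+ 2 * (M ^ d)%:R <=
   #|` P|%:R * \sum_(j : {ffun 'I_d -> 'I_M}) normc (g (grid R d M j)) ^+ 2.
Proof.
case=> a ga; pose W := (\sum_(q <- P) \sum_(i < d) `|q 0%R i|)%N.
(* [W] bounds every coordinate of every frequency, so differences are at most 2W < M. *)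
exists (W + W).+1 => M WM x; have M0 : (0 < M)%N by apply: leq_trans WM.
have qW q i : q \in P -> (`|q 0%R i| <= W)%N.
  by move=> qP; rewrite /W (big_fsetD1 q)//= (bigD1 i)//= -addnA leq_addr.
have PM q r i : q \in P -> r \in P -> (`|q 0%R i - r 0%R i| < M)%N.
  move=> qP rP; apply: leq_ltn_trans (leqD_dist _ 0 _) _.
  by rewrite subr0 sub0r abszN (leq_ltn_trans _ WM)// leq_add// qW.
have PE : \sum_(j : {ffun 'I_d -> 'I_M}) normc (g (grid R d M j)) ^+ 2 =
    (M ^ d)%:R * \sum_(q <- P) normc (a q) ^+ 2.
  apply: (@complexI R); have := parseval_grid P a M M0 PM.
  rewrite rmorphM !rmorph_sum/= rmorph_nat.
  under eq_bigr do rewrite normCE -rmorphXn -ga /=.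
  by under [in X in _ = _ * X]eq_bigr do rewrite normCE -rmorphXn /=.
rewrite PE mulrCA mulrC ler_wpM2l ?ler0n//.
apply: le_trans (sqr_sum_le _ _ _ _); apply: lerXn2r; rewrite ?nnegrE.
- exact: normc_ge0.
- by apply: sumr_ge0 => q _; exact: normc_ge0.
by rewrite ga; exact: normc_sum_expi_le.
Qed.

End Parseval.

(** * Frequencies of a power *)

Lemma bin_le_exp2 n k : ('C(n, k) <= 2 ^ n)%N.
Proof.
elim: n k => [|n IH] [|k]; rewrite ?bin0 ?bin0n ?expn_gt0//.
by rewrite binS expnS mul2n -addnn leq_add.
Qed.

Section Powers.
Variables (R : realType) (d : nat).

(** A sum of n elements of [Q] depends only on how often each of the m+1 elements occurs, and C(m+n,
    m) vectors of m+1 multiplicities have total n. *)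
Lemma trig_poly_exp (Q : {fset 'rV[int]_d}) (f : 'rV[R]_d -> R[i]) m n :
  #|` Q| = m.+1 -> trig_poly Q f ->
  exists2 P : {fset 'rV[int]_d}, (#|` P| <= 'C(m + n, m))%N &
    trig_poly P (fun x => f x ^+ n).
Proof.
move=> Qm [c fc]; pose k (j : 'I_m.+1) := nth 0 (enum_fset Q) j.
(* [t] records how often each element of [Q] occurs in a sum of [n] of them. *)
pose K (t : m.+1.-tuple 'I_n.+1) := \sum_j k j *+ tnth t j.
pose S := [set t : m.+1.-tuple 'I_n.+1 | (\sum_(i <- t) i == n)%N]%SET.
pose P := [fset K t | t in S]%fset.
pose q (h : {ffun 'I_n -> 'I_m.+1}) := \sum_i k (h i).
exists P; first by rewrite (leq_trans (leq_imfset_card _ _ _))// -card_ord_partitions cardE.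
have qP h : q h \in P.
  have cn j : (#|[set i | h i == j]%SET| < n.+1)%N.
    by rewrite ltnS -[leqRHS]card_ord max_card.
  pose t := [tuple Ordinal (cn j) | j < m.+1].
  apply/imfsetP; exists t => /=.
    rewrite inE big_tuple; apply/eqP.
    under eq_bigr do rewrite tnth_mktuple /= -sum1dep_card.
    rewrite -[RHS]card_ord -sum1_card [RHS](partition_big h xpredT)//=.
  rewrite /q /K (partition_big h xpredT)//=; apply: eq_bigr => j _.
  rewrite tnth_mktuple/= (eq_bigr (fun=> k j)) => [|i /eqP->//].
  by rewrite sumr_const cardsE.
exists (fun r => \sum_(h | q h == r) \prod_i c (k (h i))) => x.
have -> : f x = \sum_(j < m.+1) c (k j) * expi (dotZR (k j) x).
  by rewrite fc (big_nth 0) big_mkord Qm.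
(* Writing n as the size of ['I_n] expands the power into a sum over words [h] of length n. *)
rewrite -[n in LHS]card_ord -prodr_const bigA_distr_bigA/=.
under [RHS]eq_bigr do rewrite mulr_suml big_mkcond.
rewrite exchange_big/=; apply: eq_bigr => h _.
rewrite (big_fsetD1 (q h))//= eqxx [X in _ + X]big_seq [X in _ + X]big1 ?addr0 => [|r].
  by rewrite big_split/= /q dotZR_sum expi_sum.
by rewrite !inE eq_sym => /andP[/negbTE->].
Qed.

End Powers.

(** * Grid points in a slightly enlarged box *)

(** The left product is a polynomial in h, hence continuous at 0. This makes the cost in volume of
    enlarging all sides of a box arbitrarily small. *)
Lemma prod_addr_near0 (R : realType) (n : nat) (s : 'I_n -> R) (e : R) : 0 < e ->
  exists2 h, 0 < h & \prod_i (s i + h) <= \prod_i s i + e.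
Proof.
move=> e0; pose p := \prod_i ((s i)%:P + 'X) : {poly R}.
have pE h : p.[h] = \prod_i (s i + h).
  by rewrite horner_prod; apply: eq_bigr => i _; rewrite !hornerE.
have p0 : p.[0] = \prod_i s i by rewrite pE; apply: eq_bigr => i _; rewrite addr0.
have : \forall h \near (0 : R), p.[h] < \prod_i s i + e.
  apply: (cvgr_lt _ (@continuous_horner R p 0)); rewrite p0; lra.
case/nbhs_ballP => r /= r0 hr; exists (r / 2); first lra.
rewrite -pE; apply: ltW; apply: hr; rewrite /ball /= sub0r normrN gtr0_norm; lra.
Qed.

(** If l0 and l1 are the extreme admissible indices, there are at most l1 - l0 + 1 of them, while h
    (l1 - l0) <= b - a. *)
Lemma card_progression_le (R : realFieldType) (M : nat) (a b h : R) : 0 < h ->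
  #|[pred l : 'I_M | a <= h * l%:R <= b]|%:R * h <= Num.max 0 (b - a) + h.
Proof.
move=> h0; set A := [pred l : 'I_M | _].
case: (pickP A) => [l Al|A0]; last first.
  by rewrite (eq_card0 A0) mul0r addr_ge0 ?le_max ?lexx// ltW.
case: (@arg_minnP _ l A (fun i => i : nat) Al) => l0 /andP[al0 _] minl0.
case: (@arg_maxnP _ l A (fun i => i : nat) Al) => l1 Al1 maxl1.
have /andP[_ l1b] := Al1.
have l01 : (l0 <= l1)%N by exact: minl0.
have cA : (#|A| <= (l1 - l0).+1)%N.
  rewrite -(size_iota l0 (l1 - l0).+1) cardE -(size_map val).
  apply: uniq_leq_size; first by rewrite map_inj_uniq ?enum_uniq//; exact: val_inj.
  move=> n; case/mapP => i; rewrite mem_enum => Ai ->; rewrite mem_iota addnS subnKC//.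
  by rewrite ltnS minl0//=; exact: maxl1.
have : #|A|%:R <= l1%:R - l0%:R + 1 :> R by rewrite -natrB// natr1 ler_nat.
rewrite -(ler_pM2r h0) => /le_trans; apply.
have : b - a <= Num.max 0 (b - a) by rewrite le_max lexx orbT.
lra.
Qed.

Section Boxes.
Variables (R : realType) (d : nat).
Implicit Types (a b x : 'rV[R]_d).

(** Open, so that compactness applies, and boolean, so that grid points in it can be counted. For
    eta > 0 it contains the closed box, even one of volume zero. *)
Definition thick_box (eta : R) (o : option ('rV[R]_d * 'rV[R]_d)) : {pred 'rV[R]_d} :=
  fun x => if o is Some ab
    then [forall i, ab.1 0 i - eta < x 0 i < ab.2 0 i + eta] else false.

Lemma open_thick_box eta o : open [set x | thick_box eta o x].
Proof.
case: o => [[a b]|]/=; last by rewrite (_ : mkset _ = set0); [exact: open0|apply/seteqP; split].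
rewrite openE => x /= /forallP xab.
have : \forall y \near x, forall i, a 0 i - eta < (y : 'rV[R]_d) 0 i < b 0 i + eta.
  apply: (@filter_forall _ _ (fun i (y : 'rV[R]_d) =>
    a 0 i - eta < y 0 i < b 0 i + eta) (nbhs x) _) => i; have /andP[ax xb] := xab i.
  have c := @coord_continuous R 1 d 0 i x.
  near=> y; apply/andP; split; near: y.
    exact: (cvgr_gt _ c _ ax).
  exact: (cvgr_lt _ c _ xb).
by apply: filterS => y yab; apply/forallP.
Unshelve. all: by end_near. Qed.

Lemma count_thick_box o (e : R) : 0 < e -> exists2 eta, 0 < eta &
  exists M0, forall M, (M0 <= M)%N ->
    #|[pred j : {ffun 'I_d -> 'I_M} | thick_box eta o (grid R d M j)]|%:R *
      (2 * pi / M%:R) ^+ d <= obox_vol o + e.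
Proof.
move=> e0; case: o => [[a b]|]; last first.
  exists 1 => //; exists 0%N => M _; rewrite eq_card0// mul0r /= add0r ltW//.
pose s i := Num.max 0 (b 0 i - a 0 i).
have [h h0 sh] := prod_addr_near0 R d s e e0.
(* Each side may grow by h in total: h/3 at either end, and h/3 for the grid spacing, which is the
   error of [card_progression_le]. *)
exists (h / 3); first lra.
have p0 : 0 < 2 * pi :> R by rewrite mulr_gt0 ?pi_gt0.
exists (Num.bound (2 * pi / (h / 3))).+1 => M hM.
have M0 : 0 < M%:R :> R by rewrite ltr0n (leq_trans _ hM).
set g := 2 * pi / M%:R; have g0 : 0 < g by rewrite divr_gt0.
have gh : g <= h / 3.
  rewrite ler_pdivrMr// [_ * M%:R]mulrC -ler_pdivrMr; last lra.
  have q0 : 0 <= 2 * pi / (h / 3) by rewrite divr_ge0 ?ltW//; lra.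
  apply: ltW; apply: lt_le_trans (archi_boundP q0) _.
  by rewrite ler_nat ltnW.
apply: le_trans sh => /=.
(* The grid points in the thick box lie in a product of one-dimensional progressions. *)
pose A i := [pred l : 'I_M | a 0 i - h / 3 <= g * l%:R <= b 0 i + h / 3].
apply: (@le_trans _ _ (\prod_i (#|A i|%:R * g))).
  rewrite big_split/= prodr_const card_ord ler_wpM2r ?exprn_ge0 ?(ltW g0)//.
  rewrite -natr_prod ler_nat.
  have -> : (\prod_(i < d) #|A i| = #|family A|)%N.
    by rewrite card_family foldrE big_map big_enum.
  apply: subset_leq_card; apply/fintype.subsetP => j; rewrite inE => /forallP jab.
  apply/familyP => i; rewrite inE; have := jab i; rewrite /= mxE.
  by rewrite mulrAC => /andP[/ltW-> /ltW->].
apply: ler_prod => i _; rewrite mulr_ge0 ?(ltW g0)//=.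
apply: le_trans (card_progression_le _ _ _ _ _ g0) _.
have : Num.max 0 (b 0 i + h / 3 - (a 0 i - h / 3)) <= s i + h / 3 + h / 3.
  have : b 0 i - a 0 i <= s i by rewrite le_max lexx orbT.
  have : 0 <= s i by rewrite le_max lexx.
  rewrite ge_max; lra.
lra.
Qed.

End Boxes.

(** * Grid points in a covered closed set *)

Section Cover.
Variables (R : realType) (d : nat).
Implicit Types (K : set 'rV[R]_d) (F G : nat -> option ('rV[R]_d * 'rV[R]_d)).

Lemma box_vol_ge0 (a b : 'rV[R]_d) : 0 <= box_vol a b.
Proof. by apply: prodr_ge0 => i _; rewrite le_max lexx. Qed.

Lemma obox_vol_ge0 (o : option ('rV[R]_d * 'rV[R]_d)) : 0 <= obox_vol o.
Proof. by case: o => [[a b]|]//=; exact: box_vol_ge0. Qed.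

Lemma sum_half_powers_le (m : nat) : \sum_(n < m) (2 : R) ^- n.+1 <= 1.
Proof.
suff -> : \sum_(n < m) (2 : R) ^- n.+1 = 1 - 2 ^- m.
  by rewrite lerBlDr lerDl invr_ge0 exprn_ge0.
elim: m => [|m IH]; first by rewrite big_ord0 expr0 invr1 subrr.
by rewrite big_ord_recr/= IH exprS invfM; field; rewrite expf_neq0.
Qed.

(* [KG] holds as soon as the closed boxes of [G] cover [K]. *)
Lemma count_compact K G (V V' : R) : compact K ->
  (forall eta : nat -> R, (forall n, 0 < eta n) ->
     K `<=` \bigcup_n [set x | thick_box R d (eta n) (G n) x]) ->
  (forall m, \sum_(n < m) obox_vol (G n) <= V) -> V < V' ->
  exists M0, forall M, (M0 <= M)%N ->
    #|[pred j : {ffun 'I_d -> 'I_M} | grid R d M j \in K]|%:R *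
      (2 * pi / M%:R) ^+ d <= V'.
Proof.
(* The slack V' - V is shared among the boxes as a geometric series. *)
move=> cK KG GV VV'; pose e n := (V' - V) * 2 ^- n.+1.
have e0 n : 0 < e n by rewrite mulr_gt0 ?invr_gt0 ?exprn_gt0//; lra.
have /choice[eta] : forall n, exists eta : R, 0 < eta /\
   exists M0, forall M, (M0 <= M)%N ->
    #|[pred j : {ffun 'I_d -> 'I_M} | thick_box R d eta (G n) (grid R d M j)]|%:R *
      (2 * pi / M%:R) ^+ d <= obox_vol (G n) + e n.
  by move=> n; have [h h0 ?] := count_thick_box R d (G n) _ (e0 n); exists h.
move=> etaP; have eta0 n := (etaP n).1.
have /choice[M_ M_P] := fun n => (etaP n).2.
move: cK; rewrite compact_cover => /(_ nat setT
  (fun n => [set x | thick_box R d (eta n) (G n) x])) []; last 1 first.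
(* The finite subcover [D] is enlarged to all n < m, since the volume bound is stated for initial
   segments. *)
- move=> D _ KD; pose m := (\max_(n <- D) n).+1.
  have Dm n : n \in D -> (n < m)%N by move=> nD; rewrite ltnS; exact: leq_bigmax_seq.
  exists (\max_(n < m) M_ n) => M hM.
  set g := 2 * pi / M%:R.
  have g0 : 0 <= g by rewrite divr_ge0 ?mulr_ge0 ?pi_ge0.
  pose A n := [pred j : {ffun 'I_d -> 'I_M} | thick_box R d (eta n) (G n) (grid R d M j)].
  apply: (@le_trans _ _ (\sum_(n < m) (#|A n|%:R * g ^+ d))).
    rewrite -mulr_suml ler_wpM2r ?exprn_ge0// -natr_sum ler_nat.
    apply: (@leq_trans #|\bigcup_(n < m) [set j in A n]|%SET).
      apply: subset_leq_card; apply/fintype.subsetP => j; rewrite !inE => /KD [n /= nD jn].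
      by apply/finset.bigcupP; exists (Ordinal (Dm n nD)) => //; rewrite inE.
    elim/big_rec2: _ => [|n U v _ IH]; first by rewrite cards0.
    by rewrite (leq_trans (leq_card_setU _ _))// leq_add ?cardsE.
  apply: (@le_trans _ _ (\sum_(n < m) (obox_vol (G n) + e n))).
    apply: ler_sum => n _; apply: M_P; apply: leq_trans hM; exact: leq_bigmax.
  rewrite big_split/= -mulr_sumr.
  have tV := GV m.
  have : (V' - V) * \sum_(n < m) 2 ^- n.+1 <= V' - V.
    by rewrite ger_pMr ?sum_half_powers_le//; lra.
  lra.
- by move=> n _; exact: open_thick_box.
- exact: KG.
Qed.

(** As a closed subset of the cube [0, 2 pi]^d, K is compact, so the count for compact sets applies
    once the given cover, which only reaches the half-open torus, is completed. *)
Lemma count_closed K F (V V' : R) : closed K ->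
  (forall x, K x -> forall i, 0 <= x 0 i <= 2 * pi) ->
  K `&` @torus R d `<=` \bigcup_n obox (F n) ->
  (forall m, \sum_(n < m) obox_vol (F n) <= V) -> V < V' ->
  exists M0, forall M, (M0 <= M)%N ->
    #|[pred j : {ffun 'I_d -> 'I_M} | grid R d M j \in K]|%:R *
      (2 * pi / M%:R) ^+ d <= V'.
Proof.
move=> clK Kcube KF FV VV'.
have cK : compact K.
  apply: (subclosed_compact clK (@rV_compact R d (fun=> `[0, 2 * pi]%classic) _)).
    by move=> _; exact: segment_compact.
  by move=> x Kx i; rewrite /= in_itv/=; exact: Kcube.
(* K may meet the faces x_i = 2 pi, which the half-open torus omits: they are
   added to the cover as closed boxes of volume zero. *)
pose face (i : 'I_d) : 'rV[R]_d * 'rV[R]_d :=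
  (\row_k (if k == i then 2 * pi else 0), const_mx (2 * pi)).
pose G n := if @insub nat (fun m => m < d)%N 'I_d n is Some i
  then Some (face i) else F (n - d)%N.
apply: (count_compact K G V V' cK) => // [eta eta0 x Kx|m].
  have [xT|] := pselect (@torus R d x).
    have [n _ xn] := KF x (conj Kx xT); exists (n + d)%N => //=.
    rewrite /G insubF ?addnK; last by rewrite ltnNge leq_addl.
    case: (F n) xn => [[a b]|]//= xab; apply/forallP => i.
    by have /andP[? ?] := xab i; have e0 := eta0 (n + d)%N; apply/andP; split; lra.
  (* A point of K outside the torus has some coordinate equal to 2 pi, so it lies on that face. *)
  move/existsNP => [i xi]; exists (val i) => //=.
  rewrite /G valK /=; apply/forallP => k; rewrite !mxE.
  have /andP[k0 k2] := Kcube x Kx k; have e0 := eta0 (val i).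
  apply/andP; split; last by rewrite (le_lt_trans k2)// ltrDl.
  case: eqP => [->|_]; last by lra.
  have /andP[i0 i2] := Kcube x Kx i.
  by move/negP: xi; rewrite i0/= -leNgt; lra.
apply: le_trans (FV m).
(* Extending the sum to d + m terms only increases it; the first d terms, the faces, vanish and the
   others are those of [F]. *)
rewrite -!(big_mkord xpredT (fun n => obox_vol (_ n))).
apply: (@le_trans _ _ (\sum_(0 <= n < d + m) obox_vol (G n))).
  rewrite (@big_cat_nat _ _ _ m 0 (d + m))//= ?leq_addl// lerDl.
  by apply: sumr_ge0 => n _; exact: obox_vol_ge0.
rewrite (@big_cat_nat _ _ _ d 0 (d + m))//= ?leq_addr// big_nat big1 ?add0r => [|n nd].
  rewrite -{1}[d]add0n big_addn addKn; rewrite le_eqVlt; apply/orP; left; apply/eqP/eq_bigr => n _.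
  by rewrite /G insubF ?addnK// ltnNge leq_addl.
rewrite /G insubT//= /box_vol (bigD1 (Ordinal nd))//= !mxE eqxx subrr maxxx mul0r//.
Qed.

End Cover.

(** * Level sets of a trigonometric polynomial *)

Section Levels.
Variables (R : realType) (d : nat).
Implicit Types (Q : {fset 'rV[int]_d}) (f : 'rV[R]_d -> R[i]).


(** The modulus is sqrt(u^2 + v^2), with real and imaginary parts u and v that are finite sums of
    real sines and cosines. Continuity makes the level set {|f| >= A/12} closed. *)
Lemma continuous_normc_trig_poly Q f : trig_poly Q f -> continuous (fun x => normc (f x)).
Proof.
case=> c fc.
have sumc (I : Type) (r : seq I) (F : I -> 'rV[R]_d -> R) :
    (forall i, continuous (F i)) -> continuous (fun x => \sum_(i <- r) F i x).
  move=> Fc; elim: r => [|i r IH].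
    rewrite (_ : (fun x => _) = cst 0); first exact: cst_continuous.
    by apply/funext => x; rewrite big_nil.
  rewrite (_ : (fun x => _) = F i \+ (fun x => \sum_(j <- r) F j x)).
    by move=> x; exact: (cvgD (Fc i x) (IH x)).
  by apply/funext => x; rewrite big_cons.
have dc k : continuous (@dotZR R d k).
  apply: sumc => i x.
  exact: (cvgM (@cst_continuous _ _ _ x) (@coord_continuous R 1 d 0 i x)).
have cosc k : continuous (fun x => cos (@dotZR R d k x)).
  by move=> x; apply: (@continuous_comp _ _ _ (@dotZR R d k) (@cos R));
    [exact: dc|exact: continuous_cos].
have sinc k : continuous (fun x => sin (@dotZR R d k x)).
  by move=> x; apply: (@continuous_comp _ _ _ (@dotZR R d k) (@sin R));
    [exact: dc|exact: continuous_sin].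
pose u x := \sum_(k <- Q) (complex.Re (c k) * cos (dotZR k x) +
  - complex.Im (c k) * sin (dotZR k x)) : R.
pose v x := \sum_(k <- Q) (complex.Re (c k) * sin (dotZR k x) +
  complex.Im (c k) * cos (dotZR k x)) : R.
have -> : (fun x => normc (f x)) = fun x => Num.sqrt (u x * u x + v x * v x).
  apply/funext => x /=; rewrite fc -!expr2.
  suff -> : \sum_(k <- Q) c k * expi (dotZR k x) = (u x +i* v x)%C by [].
  rewrite /u /v; elim: (enum_fset Q) => [|k r IH]; first by rewrite !big_nil.
  rewrite !big_cons IH; case: (c k) => a b; apply/eqP.
  by rewrite eq_complex /= !mulNr !eqxx.
have lin (F G : 'rV[int]_d -> 'rV[R]_d -> R) (a b : 'rV[int]_d -> R) :
    (forall k, continuous (F k)) -> (forall k, continuous (G k)) ->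
    continuous (fun x => \sum_(k <- Q) (a k * F k x + b k * G k x)).
  move=> Fc Gc; apply: sumc => k y.
  exact: (cvgD (cvgM (@cst_continuous _ _ _ y) (Fc k y))
               (cvgM (@cst_continuous _ _ _ y) (Gc k y))).
have uc : continuous u by exact: lin cosc sinc.
have vc : continuous v by exact: lin sinc cosc.
move=> x; apply: (@continuous_comp _ _ _ (fun x => u x * u x + v x * v x)).
  exact: (cvgD (cvgM (uc x) (uc x)) (cvgM (vc x) (vc x))).
exact: sqrt_continuous.
Qed.

Lemma normc_trig_poly_bounded Q f : trig_poly Q f ->
  exists W, forall x, normc (f x) <= W.
Proof.
case=> c fc; exists (\sum_(k <- Q) normc (c k)) => x.
by rewrite fc; exact: normc_sum_expi_le.
Qed.

Lemma normcX (z : R[i]) n : normc (z ^+ n) = normc z ^+ n.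
Proof. by elim: n => [|n IH]; rewrite ?normc1// !exprS normcM IH. Qed.

Lemma grid_torus M (j : {ffun 'I_d -> 'I_M}) : (0 < M)%N -> @torus R d (grid R d M j).
Proof.
move=> M0 i; rewrite mxE; have p0 := pi_gt0 R.
have MR : 0 < M%:R :> R by rewrite ltr0n.
rewrite divr_ge0 ?mulr_ge0 ?(ltW p0)//= ltr_pdivrMr// ltr_pM2l ?mulr_gt0//.
by rewrite ltr_nat.
Qed.

(** The bound by Cauchy-Schwarz and Parseval is applied to f^n with n = |Q|. Grid points with |f| >=
    A/12 contribute at most (2 A^2)^n each, as (4/3)^2 < 2; all others at most (A^2/144)^n. The
    factor 4^n for the number of frequencies turns 2^n into 8^n and 144^n into 36^n. *)
Lemma large_values_on_grid Q f m (L : R) x0 : #|` Q| = m.+1 -> trig_poly Q f ->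
  0 < normc (f x0) -> (forall x, @torus R d x -> normc (f x) <= L) ->
  L <= 4 / 3 * normc (f x0) ->
  exists M0, forall M, (M0 <= M)%N ->
   (35 / 36 : R) * (M ^ d)%:R <= 8 ^+ m.+1 *
     #|[pred j : {ffun 'I_d -> 'I_M} | normc (f x0) / 12 <= normc (f (grid R d M j))]|%:R.
Proof.
set A := normc (f x0) => Qm fQ A0 fL LA.
set n := m.+1.
have [P Pn gP] := trig_poly_exp R d Q f m n Qm fQ.
have [M0 M0P] := sqr_normc_le_grid R d P _ gP.
exists M0.+1 => M hM; have Mpos : (0 < M)%N by apply: leq_trans hM.
have := M0P M (ltnW hM) x0.
set S := [pred j | _]; set D := (M ^ d)%:R => main.
pose a := (A ^+ 2) ^+ n; have a0 : 0 < a by rewrite !exprn_gt0.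
(* Here m + n = 2n - 1, so the binomial coefficient is at most 2^(2n). *)
have P4 : #|` P|%:R <= 4 ^+ n :> R.
  rewrite -natrX ler_nat (leq_trans Pn)// (leq_trans (bin_le_exp2 _ _))//.
  by rewrite -[4%N]/(2 ^ 2)%N -expnM leq_pexp2l// mul2n -addnn leq_add2r leqnSn.
have sumP : \sum_(j : {ffun 'I_d -> 'I_M}) normc (f (grid R d M j) ^+ n) ^+ 2 <=
    #|S|%:R * (2 ^+ n * a) + D * (a / 144 ^+ n).
  have -> : D = #|{ffun 'I_d -> 'I_M}|%:R by rewrite card_ffun !card_ord.
  rewrite -sum1_card natr_sum mulr_suml -sum1_card natr_sum mulr_suml.
  rewrite [X in X + _]big_mkcond -big_split/=; apply: ler_sum => j _.
  rewrite normcX -exprM mulnC exprM inE.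
  have u0 := normc_ge0 R (f (grid R d M j)).
  have uL := fL _ (grid_torus M j Mpos).
  move: (normc (f (grid R d M j))) u0 uL => u u0 uL.
  have b0 : 0 <= a / 144 ^+ n by rewrite divr_ge0 ?(ltW a0) ?exprn_ge0.
  rewrite !mul1r; case: ifPn => [_|]; rewrite ?add0r.
    rewrite -[leLHS]addr0 lerD//.
    rewrite -exprMn; apply: lerXn2r; rewrite ?nnegrE.
    - exact: sqr_ge0.
    - by have := sqr_ge0 A; lra.
    - nra.
  rewrite -ltNge => uA; rewrite -expr_div_n; apply: lerXn2r; rewrite ?nnegrE.
  - exact: sqr_ge0.
  - by have := sqr_ge0 A; lra.
  - nra.
have : a * D <= 4 ^+ n * (#|S|%:R * (2 ^+ n * a) + D * (a / 144 ^+ n)).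
  move: main; rewrite normcX -exprM mulnC exprM -/A -/a => /le_trans; apply.
  apply: ler_pM; rewrite ?ler0n//; apply: sumr_ge0 => j _; exact: sqr_ge0.
have -> : 4 ^+ n * (#|S|%:R * (2 ^+ n * a) + D * (a / 144 ^+ n)) =
    a * (8 ^+ n * #|S|%:R + D / 36 ^+ n).
  have -> : (8 : R) ^+ n = 4 ^+ n * 2 ^+ n by rewrite -exprMn; congr (_ ^+ _); lra.
  have -> : (144 : R) ^+ n = 4 ^+ n * 36 ^+ n by rewrite -exprMn; congr (_ ^+ _); lra.
  have : (4 : R) ^+ n != 0 by rewrite expf_neq0// pnatr_eq0.
  have : (36 : R) ^+ n != 0 by rewrite expf_neq0// pnatr_eq0.
  move: (4 ^+ n) (36 ^+ n) (2 ^+ n) => p q r q0 r0.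
  by field; rewrite q0 r0.
rewrite ler_pM2l// => DS.
(* Since n >= 1, the small values account for at most 1/36 of the total, leaving 35/36. *)
have : D / 36 ^+ n <= D / 36.
  rewrite ler_wpM2l ?ler0n// lef_pV2 ?posrE ?exprn_gt0//.
  by rewrite /n exprS ler_peMr// exprn_ege1//; lra.
lra.
Qed.

(** Some cover has total volume below V; this volume is finite and serves as V', which allows the
    counting to stay in the reals. *)
Lemma leb_outer_cover (B : set 'rV[R]_d) (V : R) : (leb_outer B < V%:E)%E ->
  exists F : nat -> option ('rV[R]_d * 'rV[R]_d), B `<=` \bigcup_n obox (F n) /\
   exists2 V', V' < V & forall m, \sum_(n < m) obox_vol (F n) <= V'.
Proof.
move=> /ereal_inf_lt[_ [F [BF ->]] sV]; exists F; split => //.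
set s := (X in (X < _)%E) in sV.
have part m : ((\sum_(n < m) obox_vol (F n))%:E <= s)%E.
  rewrite -sumEFin -(big_mkord xpredT (fun n => (obox_vol (F n))%:E)).
  by apply: nneseries_lim_ge => n _ _; rewrite lee_fin obox_vol_ge0.
have s0 : (0 <= s)%E by have := part 0%N; rewrite big_ord0.
have sfin : s \is a fin_num by rewrite ge0_fin_numE// (lt_trans sV) ?ltry.
exists (fine s); first by rewrite -lte_fin fineK.
by move=> m; rewrite -lee_fin fineK.
Qed.

(** Otherwise some nearly maximal A = |f(x0)| exceeds 12 A', so {|f| >= A/12} lies in B within the
    torus. Counting its grid points from above by the volume of a cover and from below by
    [large_values_on_grid] gives 35/36 <= 1/2. *)
Lemma norm_le_off_small_set Q f (B : set 'rV[R]_d) (A' : R) : Q != fset0 ->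
  trig_poly Q f ->
  (leb_outer B < ((2 * pi) ^+ d * (2^-1 * 8 ^- #|` Q|))%:E)%E -> 0 <= A' ->
  (forall x, @torus R d x -> ~ B x -> normc (f x) <= A') ->
  forall x, @torus R d x -> normc (f x) <= 12 * A'.
Proof.
move=> Q0 fQ /leb_outer_cover[F [BF [V VV' FV]]] A'0 fA' x1 x1T.
rewrite leNgt; apply/negP => fx1.
have [W fW] := normc_trig_poly_bounded Q f fQ.
pose E := [set normc (f x) | x in @torus R d].
have supE : has_sup E.
  by split; [exists (normc (f x1)), x1|exists W => _ [x _ <-]].
pose L := sup E.
have fL x : @torus R d x -> normc (f x) <= L.
  by move=> xT; apply: ub_le_sup; [exact: supE.2|exists x].
have L1 := fL _ x1T.
have L0 : 0 < L by lra.
(* The minimum secures both |f(x0)| > 3L/4 and |f(x0)| > 12 A'. *)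
have [_ [x0 x0T <-] x0L] : exists2 y, E y & L - Num.min (L / 4) (L - 12 * A') < y.
  by apply: sup_adherent => //; rewrite lt_min; lra.
have x0L1 : L / 4 * 3 < normc (f x0).
  by apply: le_lt_trans x0L; have := ge_min (L/4) (L/4) (L - 12 * A'); rewrite lexx /=; lra.
have x0L2 : 12 * A' < normc (f x0).
  apply: le_lt_trans x0L.
  by have := ge_min (L - 12 * A') (L/4) (L - 12 * A'); rewrite lexx orbT /=; lra.
have [m Qm] : exists m, #|` Q| = m.+1.
  by exists #|` Q|.-1; rewrite prednK// cardfs_gt0.
have [M0 M0P] : _ := large_values_on_grid Q f m L x0 Qm fQ ltac:(lra) fL ltac:(lra).
set A := normc (f x0) in x0L x0L1 x0L2 M0P.
pose K := [set x : 'rV[R]_d | forall i, 0 <= x 0 i <= 2 * pi] `&`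
   [set x | A / 12 <= normc (f x)].
have clK : closed K.
  apply: closedI.
    rewrite (_ : mkset _ = \bigcap_i ((fun x : 'rV[R]_d => x 0 i) @^-1` `[0, 2 * pi])).
      apply: closed_bigI => i _; apply: preimage_closed; last exact: interval_closed.
      by move=> x _; exact: coord_continuous.
    by apply/seteqP; split => x /= xK i; have := xK i; rewrite /= in_itv/=; [|apply].
  apply: (@preimage_closed _ _ (fun x => normc (f x)) [set y | A / 12 <= y]); last exact: closed_ge.
  by move=> x _; exact: (continuous_normc_trig_poly Q f fQ).
have KF : K `&` @torus R d `<=` \bigcup_n obox (F n).
  move=> x [[_ /= Ax] xT]; apply: BF; apply: contrapT => xB.
  by have := fA' x xT xB; lra.
have [M1 M1P] := count_closed R d K F V _ clK (fun x xK => xK.1) KF FV VV'.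
pose M := (maxn M0 M1).+1.
have := M0P M (leqW (leq_maxl _ _)); have := M1P M (leqW (leq_maxr _ _)).
have p0 := pi_gt0 R.
have MR : 0 < M%:R :> R by rewrite ltr0n.
rewrite expr_div_n mulrA ler_pdivrMr ?exprn_gt0// [leLHS]mulrC -mulrA.
rewrite ler_pM2l ?exprn_gt0 ?mulr_gt0// Qm.
set S := [pred j | _]; set T := [pred j | _].
(* Grid points lie in the cube, so for them membership in [K] only concerns the size of f. *)
have -> : #|S| = #|T|.
  apply: eq_card => j; apply/idP/idP; rewrite !inE; first by case.
  move=> Aj.
  split => // i; have /andP[-> /ltW->//] := grid_torus M j isT i.
rewrite natrX => h1 h2.
have := le_trans h2 (ler_wpM2l (exprn_ge0 m.+1 (ler0n _ 8)) h1).
have -> : 8 ^+ m.+1 * (2^-1 * 8 ^- m.+1 * M%:R ^+ d) = M%:R ^+ d / 2 :> R.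
  by field; rewrite expf_neq0.
have : 0 < (M%:R : R) ^+ d by rewrite exprn_gt0.
lra.
Qed.

End Levels.

(** * Passage to normalized measure and extended sup norms *)

Theorem theorem5p4 (R : realType) (d : nat) :
  exists c : R, 0 < c /\
  forall (Q : {fset 'rV[int]_d}) (B : set 'rV[R]_d) (f : 'rV[R]_d -> R[i]),
    Q != fset0 ->
    B `<=` @torus R d ->
    leb_measurable B ->
    (nmeasure B <= (c * 2 ^- (4 * #|` Q|) * (#|` Q|%:R) ^- 2)%:E)%E ->
    trig_poly Q f ->
    (sup_norm f (@torus R d) <= 12%:E * sup_norm f (@torus R d `\` B))%E.
Proof.
(* With N = |Q|, the inequalities 2^(-4N) <= 8^-N and N^-2 <= 1 leave at most 8^-N / 4, strictly
   below the threshold 8^-N / 2. *)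
exists 4^-1; split; first by rewrite invr_gt0.
move=> Q B f Q0 BT _ mB fQ.
have p0 := pi_gt0 R; have N0 : (0 < #|` Q|)%N by rewrite cardfs_gt0.
have Bsmall : (leb_outer B < ((2 * pi) ^+ d * (2^-1 * 8 ^- #|` Q|))%:E)%E.
  have pd : 0 < (2 * pi : R) ^+ d by rewrite exprn_gt0 ?mulr_gt0.
  move: mB; rewrite /nmeasure lee_pdivrMl// => /le_lt_trans; apply.
  rewrite -EFinM lte_fin ltr_pM2l//.
  set N := #|` Q| in N0 *.
  have n1 : (N%:R : R) ^- 2 <= 1.
    by rewrite invf_le1 ?exprn_gt0 ?ltr0n// exprn_ege1// ler1n.
  have n8 : (2 : R) ^- (4 * N) <= 8 ^- N.
    rewrite lef_pV2 ?posrE ?exprn_gt0// exprM; apply: lerXn2r; rewrite ?nnegrE; lra.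
  have e0 : 0 < (8 : R) ^- N by rewrite invr_gt0 exprn_gt0.
  apply: (@le_lt_trans _ _ (4^-1 * 8 ^- N)); last lra.
  have q0 : 0 <= 4^-1 * (2 : R) ^- (4 * N).
    by apply: mulr_ge0; rewrite invr_ge0 ?exprn_ge0.
  by apply: le_trans (ler_piMr q0 n1) _; rewrite ler_wpM2l// invr_ge0.
have T0 : @torus R d 0 by move=> i; rewrite mxE lexx mulr_gt0.
(* Were B to contain the torus, the real bound with A' = 0 would hold vacuously off B for a single
   exponential and give 1 <= 0. The point [x2] keeps the sup norm off B from being -oo. *)
have [x2 [x2T x2B]] : exists x, @torus R d x /\ ~ B x.
  apply: contrapT => /forallNP noB.
  have [k kQ] := fset0Pn _ Q0.
  have e1 : trig_poly Q (fun x : 'rV[R]_d => expi (dotZR k x)).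
    exists (fun q => (q == k)%:R) => x.
    rewrite (big_fsetD1 k)//= eqxx mul1r big_seq big1 ?addr0// => q.
    by rewrite !inE => /andP[/negbTE-> _]; rewrite mul0r.
  have := norm_le_off_small_set R d Q _ B 0 Q0 e1 Bsmall (lexx 0) _ 0 T0.
  rewrite normc_expi mulr0 ler10 => /(_ _)/negP; case; last by [].
  by move=> x xT xB; case: (noB x).
have [W fW] := normc_trig_poly_bounded R d Q f fQ.
set s := sup_norm f (_ `\` _).
have fs x : @torus R d x -> ~ B x -> ((normc (f x))%:E <= s)%E.
  by move=> xT xB; apply: ereal_sup_ubound; exists x.
have s0 : (0 <= s)%E by apply: le_trans (fs _ x2T x2B); rewrite lee_fin normc_ge0.
have sW : (s <= W%:E)%E by apply: ge_ereal_sup => _ [x _ <-]; rewrite lee_fin.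
have sfin : s \is a fin_num by rewrite ge0_fin_numE// (le_lt_trans sW) ?ltry.
apply: ge_ereal_sup => _ [x xT <-].
rewrite -(fineK sfin) -EFinM lee_fin.
apply: (norm_le_off_small_set R d Q f B _ Q0 fQ Bsmall) => //; first exact: fine_ge0.
by move=> y yT yB; rewrite -lee_fin fineK// fs.
Qed.
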